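(* The barycenter of a circular segment divides the diameter of the segment so that the part near the vertex is greater than the rest, but less than three halves of it. That is, if a circular segment $ABC$ has base $AC$, vertex $B$, diameter $BD$ and barycenter $L$ (which lies on $BD$), then $$LD < BL < \tfrac{3}{2}\, LD .$$
   Context: A circular segment $ABC$ is the plane region enclosed by an arc of a circle with endpoints $A$, $C$ and the chord (base) $AC$. Its vertex $B$ is the midpoint of the arc, i.e. the point of the arc most distant from the chord. Its diameter $BD$ is the straight line from $B$ to the midpoint $D$ of the base $AC$ (perpendicular to $AC$); it is part of a diameter of the full circle. The barycenter is the centroid of the region with uniform density. *)

(* Defs.v *)
From HB Require Import structures.
From mathcomp Require Import all_boot all_order all_algebra.
From mathcomp Require Import all_classical all_reals all_analysis.

Set Implicit Arguments.
Unset Strict Implicit.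
Unset Printing Implicit Defensive.

Import Order.TTheory GRing.Theory Num.Theory.
Import numFieldNormedType.Exports.

Local Open Scope classical_set_scope.
Local Open Scope ring_scope.

(* The plane is [R * R].  Its library norm is the max norm, hence the explicit
   Euclidean distance. *)
Definition eucl_dist (R : realType) (P Q : R * R) : R :=
  Num.sqrt ((P.1 - Q.1) ^+ 2 + (P.2 - Q.2) ^+ 2).

Definition midpoint (R : realType) (P Q : R * R) : R * R :=
  ((P.1 + Q.1) / 2, (P.2 + Q.2) / 2).

Definition closed_segment (R : realType) (P Q : R * R) : set (R * R) :=
  [set X | exists2 t : R, 0 <= t <= 1 &
     X = ((1 - t) * P.1 + t * Q.1, (1 - t) * P.2 + t * Q.2)].

(* Twice the signed area of the triangle PQX: its sign tells on which side of
   the line PQ the point X lies. *)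
Definition orient (R : realType) (P Q X : R * R) : R :=
  (Q.1 - P.1) * (X.2 - P.2) - (Q.2 - P.2) * (X.1 - P.1).

Local Notation area R := (@lebesgue_measure R \x @lebesgue_measure R)%E.

(* Centroid for the uniform density.  Meaningful for regions of finite
   positive area on which the coordinates are integrable. *)
Definition barycenter (R : realType) (S : set (R * R)) : R * R :=
  ((\int[area R]_(P in S) P.1) / fine (area R S),
   (\int[area R]_(P in S) P.2) / fine (area R S)).

Definition circle_point (R : realType) (O : R * R) (r t : R) : R * R :=
  (O.1 + r * cos t, O.2 + r * sin t).

(* The arc run through counterclockwise from angle [a] to angle [b]; a proper
   arc of the circle when [a < b < a + 2 * pi]. *)
Definition circle_arc (R : realType) (O : R * R) (r a b : R) : set (R * R) :=
  [set circle_point O r t | t in `[a, b]].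

(* The part of the closed disc cut off by the chord on the side of the arc.
   The arc may be smaller than, equal to or greater than a semicircle. *)
Definition circular_segment (R : realType) (O : R * R) (r a b : R) :
    set (R * R) :=
  let A := circle_point O r a in
  let C := circle_point O r b in
  [set P | eucl_dist O P <= r /\
           forall Q, circle_arc O r a b Q -> 0 <= orient A C Q * orient A C P].

Definition segment_vertex (R : realType) (O : R * R) (r a b : R) : R * R :=
  circle_point O r ((a + b) / 2).

Definition segment_base_midpoint (R : realType) (O : R * R) (r a b : R) : R * R :=
  midpoint (circle_point O r a) (circle_point O r b).

(* Main.v *)
Require Import Defs.
From HB Require Import structures.
From mathcomp Require Import all_boot all_order all_algebra.
From mathcomp Require Import all_classical all_reals all_analysis.
From mathcomp Require Import measurable_realfun ring lra.

Set Implicit Arguments.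
Unset Strict Implicit.
Unset Printing Implicit Defensive.

Import Order.TTheory GRing.Theory Num.Theory.
Import numFieldNormedType.Exports.

Local Open Scope classical_set_scope.
Local Open Scope ring_scope.

(* The circular segment is a rotated and translated copy of the upright segment
   {x^2 + y^2 <= r^2, d <= x}; rotations are products of shears, and shears
   preserve area by translation invariance along the slices.  By symmetry the
   barycenter is (s, 0), where s is the mean of x for the weight
   w(x) = sqrt(r^2 - x^2) on [d, r].  With s between d and r, the claim is
   (2r + 3d) / 5 < s < (r + d) / 2.  Each bound compares w with a weight whose
   mean is exactly the bound:
   - for the upper one, with m = (r + d) / 2, the weight
     sqrt(r^2 - m^2 - (x - m)^2), symmetric about m, which is below w to the
     left of m and above it to the right;
   - for the lower one, with x0 = (2r + 3d) / 5, the weight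
     sqrt(r + x0) sqrt(r - x) of a parabolic segment, since
     w(x) = sqrt(r + x) sqrt(r - x). *)

Local Notation area R := (@lebesgue_measure R \x @lebesgue_measure R)%E.

(** * Area-preserving maps of the plane and change of variables *)

Section area_preserving.
Context {R : realType}.
Notation line := (measurableTypeR R).
Notation plane := (line * line)%type.
Notation leb := (@lebesgue_measure R).

(** The pushforward of Lebesgue measure under a translation gives half-open intervals their usual
    length, and this determines the measure. *)
Lemma lebesgue_measure_preimage_addr (k : R) (A : set line) : measurable A ->
  leb ((fun y : line => y + k) @^-1` A) = leb A.
Proof.
have mk : measurable_fun [set: line] (fun y : line => y + k : line).
  exact: measurable_funD.
move=> mA.
transitivity (pushforward leb (fun y : line => y + k : line) A) => //.
apply/esym/lebesgue_measure_unique => //= _ [[a b]] _ <- /=.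
rewrite /pushforward.
rewrite (_ : _ @^-1` _ = `]a - k, b - k]%classic); last first.
  by apply/seteqP; split => y /=; rewrite !in_itv/= ltrBlDr lerBrDr.
rewrite !lebesgue_measure_itv/= !lte_fin ltrD2r -!EFinB.
by congr (if _ then _%:E else _); ring.
Qed.

(** Stated with preimages, so that composition is immediate and the pushforward of the area under
    [T] is the area itself. *)
Definition area_preserving (T : plane -> plane) :=
  measurable_fun setT T /\
  forall A, measurable A -> area R (T @^-1` A) = area R A.

Lemma area_preserving_comp (T U : plane -> plane) :
  area_preserving T -> area_preserving U -> area_preserving (T \o U).
Proof.
move=> [mT hT] [mU hU]; split; first exact: measurableT_comp.
move=> A mA; rewrite comp_preimage hU ?hT//.
by rewrite -[X in measurable X]setTI; exact: mT.
Qed.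

(** The product measure integrates the lengths of vertical slices, and the slice of the preimage at
    [x] is the preimage under [phi x] of the slice of [A]. Both shears and the reflection reduce to
    this. *)
Lemma area_preserving_fibre (phi : line -> line -> line) :
  measurable_fun [set: plane] (fun P => phi P.1 P.2) ->
  (forall x A, measurable A -> leb (phi x @^-1` A) = leb A) ->
  area_preserving (fun P => (P.1, phi P.1 P.2)).
Proof.
move=> mphi hphi; split; first exact: measurable_fun_pair.
move=> A mA; apply: eq_integral => x _ /=.
rewrite -(hphi x (xsection A x)); last exact: measurable_xsection.
by congr (leb _); apply/seteqP; split => y /=; rewrite /xsection/= !inE.
Qed.

Lemma area_preserving_shear (g : line -> line) : measurable_fun setT g ->
  area_preserving (fun P => (P.1, P.2 + g P.1)).
Proof.
move=> mg; apply: (@area_preserving_fibre (fun x y => y + g x)).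
  by apply: measurable_funD => //; exact: measurableT_comp.
by move=> x A mA; exact: lebesgue_measure_preimage_addr.
Qed.

Lemma area_preserving_reflection : area_preserving (fun P => (P.1, - P.2)).
Proof.
apply: (@area_preserving_fibre (fun x y => - y)); first exact: measurableT_comp.
by move=> x A mA; exact: lebesgue_measureN.
Qed.

(** By uniqueness of the product measure it suffices to look at rectangles, whose two sides are
    exchanged. *)
Lemma area_preserving_swap : area_preserving (fun P => (P.2, P.1)).
Proof.
have mW : measurable_fun setT (fun P : plane => (P.2, P.1) : plane).
  exact: measurable_fun_pair.
split => // A mA.
transitivity (pushforward (area R) (fun P : plane => (P.2, P.1) : plane) A) => //.
apply/esym/product_measure_unique => //= B C mB mC.
rewrite /pushforward (_ : _ @^-1` _ = C `*` B).
  by rewrite product_measure1E// muleC.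
by apply/seteqP; split => -[x y] [].
Qed.

Lemma area_preserving_shear_fst (g : line -> line) : measurable_fun setT g ->
  area_preserving (fun P => (P.1 + g P.2, P.2)).
Proof.
move=> mg; have W := area_preserving_swap.
exact: (area_preserving_comp W
  (area_preserving_comp (area_preserving_shear mg) W)).
Qed.

(** A rotation is a horizontal, a vertical and again a horizontal shear. The horizontal ones have
    slope [- k], where [k = q' / (1 + p')] is the tangent of half the angle; the vertical one has
    slope [q'], the sine. *)
Lemma area_preserving_rotation (p q : R) : p ^+ 2 + q ^+ 2 = 1 ->
  area_preserving (fun P => (P.1 * p - P.2 * q, P.1 * q + P.2 * p)).
Proof.
have shears p' q' : p' ^+ 2 + q' ^+ 2 = 1 -> 1 + p' != 0 ->
    area_preserving (fun P => (P.1 * p' - P.2 * q', P.1 * q' + P.2 * p')).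
  move=> pq p1; pose k := q' / (1 + p').
  have ml c : measurable_fun [set: line] (fun x : line => x * c : line).
    exact: measurable_funM.
  have X := area_preserving_shear_fst (ml (- k)).
  have Y := area_preserving_shear (ml q').
  have := area_preserving_comp X (area_preserving_comp Y X).
  congr area_preserving; apply/funext => -[x y] /=.
  have q2 : q' ^+ 2 = (1 - p') * (1 + p') by rewrite -[1 - p']/(1 - p') ; lra.
  have kq : k * q' = 1 - p' by rewrite /k mulrAC -expr2 q2 mulfK.
  have kp : k * (1 + p') = q' by rewrite /k mulfVK.
  have yE : y + (x + y * - k) * q' = x * q' + y * p'.
    by rewrite (_ : p' = 1 - k * q'); [ring|rewrite kq; ring].
  rewrite yE; congr pair.
  transitivity (x * (1 - k * q') - y * (k * (1 + p'))); first by ring.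
  by rewrite kq kp; ring.
move=> pq; have [p1|/shears] := eqVneq (1 + p) 0; last exact.
(* the shear decomposition misses the half-turn, a composite of two quarter-turns *)
have J := shears 0 1 ltac:(ring) ltac:(rewrite addr0; exact: oner_neq0).
have := area_preserving_comp J J.
have pE : p = -1 by lra.
have -> : q = 0.
  by apply/eqP; rewrite -sqrf_eq0; apply/eqP; move: pq; rewrite pE; lra.
by congr area_preserving; apply/funext => -[x y] /=; rewrite pE; congr pair; ring.
Qed.

Lemma area_preserving_translation (O : plane) :
  area_preserving (fun P => (O.1 + P.1, O.2 + P.2)).
Proof.
have mc c : measurable_fun [set: line] (fun=> c : line) by [].
have := area_preserving_comp (area_preserving_shear_fst (mc O.1))
  (area_preserving_shear (mc O.2)).
by congr area_preserving; apply/funext => -[x y] /=; rewrite addrC (addrC y).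
Qed.

(** The area agrees with its own pushforward under [T] on measurable sets, so the integral over [S]
    may be taken against the pushforward and pulled back. *)
Lemma Rintegral_area_preserving (T : plane -> plane) (S : set plane)
    (f : plane -> R) :
  area_preserving T -> measurable S -> measurable_fun setT f ->
  (area R).-integrable (T @^-1` S) (EFin \o (f \o T)) ->
  \int[area R]_(P in S) f P = \int[area R]_(P in T @^-1` S) f (T P).
Proof.
move=> [mT hT] mS mf iT; congr fine.
transitivity (\int[pushforward (area R) T]_(P in S) (f P)%:E)%E.
  by apply: eq_measure_integral => A mA _; exact/esym/hT.
rewrite integral_pushforward//; exact/measurable_EFinP.
Qed.

End area_preserving.

(** * Positivity of one-variable integrals by comparison *)

Section one_variable.
Context {R : realType}.
Notation leb := (@lebesgue_measure R).
Implicit Types (f g G Q : R -> R) (a b d r x z : R).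

Lemma continuous_integrable_itv f a b : continuous f ->
  leb.-integrable `[a, b] (EFin \o f).
Proof.
move=> cf; apply: continuous_compact_integrable; first exact: segment_compact.
exact: continuous_subspaceT.
Qed.

Lemma Rintegral_itv_gt0 f a b z : continuous f -> a < z < b ->
  (forall x, a <= x <= b -> 0 <= f x) -> 0 < f z ->
  0 < \int[leb]_(x in `[a, b]) f x.
Proof.
move=> cf /andP[az zb] f0 fz.
have /nbhs_ballP[e /= e0 fe] : \forall x \near z, f z / 2 < f x.
  by apply: (cvgr_gt (f z) (cf z)); lra.
(* A closed neighbourhood of [z] inside the ball where [f] exceeds [f z / 2], clipped to [[a, b]];
   it has positive length because [z] is interior. *)
pose u := Num.max a (z - e / 2); pose v := Num.min b (z + e / 2).
have [au zu uz] : [/\ a <= u, z - e / 2 <= u & u < z].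
  by rewrite /u !le_max !lexx orbT gt_max az/=; split => //; lra.
have [vb vz zv] : [/\ v <= b, v <= z + e / 2 & z < v].
  by rewrite /v !ge_min !lexx orbT lt_min zb/=; split => //; lra.
have uv : u < v by exact: lt_trans zv.
have uvab : `[u, v] `<=` `[a, b].
  by move=> x /=; rewrite !in_itv/= => /andP[ux xv]; lra.
have int c d := continuous_integrable_itv c d cf.
apply: (@lt_le_trans _ _ (\int[leb]_(x in `[u, v]) (f z / 2))).
  rewrite Rintegral_cst//= lebesgue_measure_itv/= lte_fin uv -EFinB/=.
  by rewrite mulr_gt0 ?subr_gt0 ?divr_gt0.
apply: (@le_trans _ _ (\int[leb]_(x in `[u, v]) f x)).
  apply: le_Rintegral => //.
    by apply: continuous_integrable_itv => x; exact: cst_continuous.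
  move=> x /=; rewrite in_itv/= => /andP[ux xv]; apply/ltW/fe.
  rewrite /ball/= ltr_norml; apply/andP; split; lra.
rewrite -lee_fin /Rintegral !fineK; [|exact: integrable_fin_num..].
apply: ge0_subset_integral => //.
by apply/measurable_EFinP; exact: measurable_funTS (continuous_measurable_fun cf).
Qed.

(** The derivative is asked for only inside the interval: the antiderivatives used later contain
    square roots, one of which has a radicand vanishing at the right end. *)
Lemma Rintegral_derivative0 g G a b : a < b -> continuous g -> continuous G ->
  (forall x, a < x < b -> is_derive x 1 G (g x)) -> G a = G b ->
  \int[leb]_(x in `[a, b]) g x = 0.
Proof.
move=> ab cg cG dG Gab; rewrite /Rintegral (@continuous_FTC2 _ g G)//.
- by rewrite Gab subee.
- exact: continuous_subspaceT.
- split.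
  + by move=> x; rewrite in_itv/= => /dG[].
  + exact: cvg_at_right_filter (cG a).
  + exact: cvg_at_left_filter (cG b).
- move=> x; rewrite in_itv/= => /dG xG; rewrite derive1E; exact: derive_val.
Qed.

(** Since [g] integrates to zero, the integral of [f] is that of the continuous function [f - g],
    nonnegative and positive at [z]. This turns each bound on the barycenter into a pointwise
    inequality. *)
Lemma Rintegral_gt0_comparison f g G a b z :
  continuous f -> continuous g -> continuous G -> a < z < b ->
  (forall x, a < x < b -> is_derive x 1 G (g x)) -> G a = G b ->
  (forall x, a <= x <= b -> g x <= f x) -> g z < f z ->
  0 < \int[leb]_(x in `[a, b]) f x.
Proof.
move=> cf cg cG /andP[az zb] dG Gab gf gfz.
have ab : a < b by exact: lt_trans zb.
have -> : \int[leb]_(x in `[a, b]) f x = \int[leb]_(x in `[a, b]) (f x - g x).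
  rewrite RintegralB ?(Rintegral_derivative0 ab cg cG dG Gab) ?subr0//;
  exact: continuous_integrable_itv.
apply: (@Rintegral_itv_gt0 _ _ _ z); rewrite ?az ?subr_gt0//.
- by move=> x; apply: continuousB; [exact: cf|exact: cg].
- by move=> x xab; rewrite subr_ge0 gf.
Qed.

(** The chain rule for the power [3 / 2] of [Q], which is written [Q y * Num.sqrt (Q y)]. *)
Lemma is_derive_mul_sqrt Q (q x : R) : 0 < Q x -> is_derive x 1 Q q ->
  is_derive x 1 (fun y => Q y * Num.sqrt (Q y)) (3 / 2 * Num.sqrt (Q x) * q).
Proof.
move=> Qx dQ.
have dS : is_derive x 1 (Num.sqrt \o Q) ((2 * Num.sqrt (Q x))^-1 * q).
  exact: is_derive1_comp (is_derive1_sqrt Qx) dQ.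
apply: (is_derive_eq (is_deriveM dQ dS)); rewrite /GRing.scale/=.
have s0 : Num.sqrt (Q x) != 0 by rewrite gt_eqF ?sqrtr_gt0.
rewrite -{1}[Q x]sqr_sqrtr ?ltW//; field; exact: s0.
Qed.

End one_variable.

(** * The upright segment and integration over its slices *)

Section upright_segment.
Context {R : realType}.
Notation line := (measurableTypeR R).
Notation plane := (line * line)%type.
Notation leb := (@lebesgue_measure R).
Implicit Types (r d : R).

Definition upright_segment r d : set plane :=
  [set P | P.1 ^+ 2 + P.2 ^+ 2 <= r ^+ 2 /\ d <= P.1].

Lemma measurable_upright_segment r d : measurable (upright_segment r d).
Proof.
rewrite (_ : upright_segment r d =
    (fun P : plane => P.1 ^+ 2 + P.2 ^+ 2 : line) @^-1` `]-oo, r ^+ 2] `&`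
    (fst : plane -> line) @^-1` `[d, +oo[); last first.
  by apply/seteqP; split => P; rewrite /upright_segment/= !in_itv/= andbT.
apply: measurableI; rewrite -[X in measurable X]setTI.
  apply: measurable_funD => //; exact: measurable_funX.
exact: measurable_fst.
Qed.

Lemma upright_segment_bounded r d P : 0 < r -> upright_segment r d P ->
  `|P.1| <= r /\ `|P.2| <= r.
Proof.
move=> /ltW r0 [Pr _].
split; rewrite -(@ler_pXn2r _ 2) ?nnegrE// real_normK ?num_real//.
  by apply: le_trans Pr; rewrite lerDl sqr_ge0.
by apply: le_trans Pr; rewrite lerDr sqr_ge0.
Qed.

Lemma area_upright_segment_lty r d : 0 < r ->
  (area R (upright_segment r d) < +oo)%E.
Proof.
move=> r0; apply: (@le_lt_trans _ _ (area R (`[- r, r] `*` `[- r, r]))).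
  apply: le_measure; rewrite ?inE.
  - exact: measurable_upright_segment.
  - exact: measurableX.
  - by move=> P /(upright_segment_bounded r0)[]; rewrite !ler_norml /= !in_itv.
rewrite product_measure1E//= lebesgue_measure_itv/=.
by case: ifPn => _; rewrite ?mul0e// -EFinB -EFinM ltry.
Qed.

Lemma integrable_upright_segment r d (f : plane -> R) M : 0 < r ->
  measurable_fun setT f ->
  (forall P, `|P.1| <= r -> `|P.2| <= r -> `|f P| <= M) ->
  (area R).-integrable (upright_segment r d) (EFin \o f).
Proof.
move=> r0 mf fM; apply: measurable_bounded_integrable.
- exact: measurable_upright_segment.
- exact: area_upright_segment_lty.
- exact: measurable_funTS.
- exists M; split; rewrite ?num_real// => N MN P.
  move=> /(upright_segment_bounded r0)[P1 P2].
  exact: le_trans (fM _ P1 P2) (ltW MN).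
Qed.

Lemma integrable_upright_segment_affine r d (p q c : R) : 0 < r ->
  (area R).-integrable (upright_segment r d)
    (EFin \o (fun P => p * P.1 + q * P.2 + c)).
Proof.
move=> r0.
apply: (@integrable_upright_segment _ _ _ (`|p| * r + `|q| * r + `|c|)) => //.
  by do 2![apply: measurable_funD => //]; exact: measurable_funM.
move=> P P1 P2; rewrite (le_trans (ler_normD _ _))// lerD2r.
by rewrite (le_trans (ler_normD _ _))// !normrM lerD// ler_wpM2l.
Qed.

(** Fubini: for [x] in [[d, r]] the vertical slice is the chord from [- w] to [w] with
    [w = Num.sqrt (r ^+ 2 - x ^+ 2)]. *)
Lemma Rintegral_upright_segment_slices r d (h : R -> R) : 0 < r -> - r <= d ->
  (area R).-integrable (upright_segment r d) (EFin \o (h \o fst)) ->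
  \int[area R]_(P in upright_segment r d) h P.1 =
  \int[leb]_(x in `[d, r]) (h x * (2 * Num.sqrt (r ^+ 2 - x ^+ 2))).
Proof.
move=> r0 rd ih; have mS := measurable_upright_segment r d.
congr fine; rewrite integral_mkcond -integral12_prod_meas1; last first.
  by move: ih => /(integrable_mkcond _ mS).
rewrite [RHS]integral_mkcond; apply: eq_integral => x _ /=.
rewrite [RHS]patchE; case: ifPn => [|xdr].
  rewrite inE/= in_itv/= => /andP[dx xr].
  set w := Num.sqrt _.
  have rx : 0 <= r ^+ 2 - x ^+ 2.
    rewrite subr_sqr mulr_ge0; lra.
  transitivity (\int[leb]_(y in `[(- w)%R, w%R]) (h x)%:E)%E.
    rewrite [RHS]integral_mkcond; apply: eq_integral => y _.
    rewrite !patchE; congr (if _ then _ else _).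
    apply/idP/idP; rewrite !inE /upright_segment /= in_itv/= -ler_norml.
      by move=> [xy _]; rewrite -sqrtr_sqr ler_sqrt//; lra.
    move=> yw; split => //.
    have : `|y| ^+ 2 <= w ^+ 2 by rewrite ler_pXn2r ?nnegrE// sqrtr_ge0.
    by rewrite real_normK ?num_real// sqr_sqrtr//; lra.
  rewrite integral_cst//= lebesgue_measure_itv/= lte_fin.
  have w0 : 0 <= w by exact: sqrtr_ge0.
  (* The interval length is a conditional on [- w < w]; in the other case [w = 0] and both sides
     vanish. *)
  case: ifPn => ww; first by rewrite -EFinB -EFinM; congr EFin; ring.
  by rewrite mule0 (_ : w = 0) ?mulr0//; lra.
(* Outside [[d, r]] the slice is empty: a point of it would have [r < x], so [x ^+ 2] alone would
   exceed [r ^+ 2]. *)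
apply: integral0_eq => y _; rewrite patchE memNset// => -[/= xy dx].
move: xdr; rewrite notin_setE/= in_itv/= dx /= => /negP; rewrite -ltNge => rx.
have : r ^+ 2 < x ^+ 2 by rewrite ltr_pXn2r ?nnegrE//; lra.
by have := sqr_ge0 y; lra.
Qed.

End upright_segment.

(** * The two bounds on the first moment, and the symmetry about the axis *)

Section centroid_of_upright_segment.
Context {R : realType}.
Implicit Types (r d : R).
Notation leb := (@lebesgue_measure R).

Local Ltac continuity := intro; repeat first
  [ exact: cvg_cst | exact: cvg_id | apply: cvgD | apply: cvgN
  | apply: cvgM
  | apply: (@continuous_cvg _ _ _ _ _ _ (fun y : R => y ^+ 2));
    [exact: exprn_continuous|]
  | apply: (@continuous_cvg _ _ _ _ _ _ Num.sqrt);
    [exact: sqrt_continuous|] ].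

(** Each claim about moment and area becomes the sign of a single integral: [0, 1] gives the area,
    [-2, r + d] the upper bound, [5, - (2 * r + 3 * d)] the lower one. *)
Lemma upright_segment_affine_moment r d p q : 0 < r -> - r < d ->
  p * (\int[area R]_(P in upright_segment r d) P.1)
    + q * fine (area R (upright_segment r d)) =
  \int[leb]_(x in `[d, r]) ((p * x + q) * (2 * Num.sqrt (r ^+ 2 - x ^+ 2))).
Proof.
move=> r0 rd.
rewrite -(Rintegral_upright_segment_slices (h := fun x => p * x + q))//;
  last 2 first.
- exact: ltW.
- have := integrable_upright_segment_affine d p 0 q r0.
  apply: eq_integrable => [|P _ /=]; first exact: measurable_upright_segment.
  by rewrite mul0r addr0.
have intc c : (area R).-integrable (upright_segment r d) (EFin \o (fun=> c)).
  by apply: (@integrable_upright_segment _ _ _ _ `|c|).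
have int1 : (area R).-integrable (upright_segment r d) (EFin \o fst).
  by apply: (@integrable_upright_segment _ _ _ _ r).
rewrite RintegralD//; last 2 first.
- exact: measurable_upright_segment.
- by apply: (integrableZl (measurable_upright_segment r d) p int1).
rewrite RintegralZl ?Rintegral_cst//; exact: measurable_upright_segment.
Qed.

Lemma area_upright_segment_gt0 r d : 0 < r -> - r < d -> d < r ->
  0 < fine (area R (upright_segment r d)).
Proof.
move=> r0 rd dr.
have := upright_segment_affine_moment 0 1 r0 rd; rewrite mul0r add0r mul1r => ->.
apply: (@Rintegral_itv_gt0 _ _ _ _ ((d + r) / 2)); first by continuity.
- by apply/andP; split; lra.
- by move=> x _; rewrite mul0r add0r mul1r mulr_ge0 ?sqrtr_ge0.
- rewrite mul0r add0r mul1r mulr_gt0// sqrtr_gt0 subr_sqr mulr_gt0; lra.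
Qed.

Lemma upright_segment_moment_lt r d : 0 < r -> - r < d -> d < r ->
  2 * (\int[area R]_(P in upright_segment r d) P.1) <
  (r + d) * fine (area R (upright_segment r d)).
Proof.
move=> r0 rd dr.
(* The square root of [Q] is the half-chord of the circle that has the chord of the given circle at
   [x = m] as a diameter. *)
pose m := (r + d) / 2; pose Q x := r ^+ 2 - m ^+ 2 - (x - m) ^+ 2.
rewrite -subr_gt0 addrC -mulNr upright_segment_affine_moment//.
have dQ (x : R) : is_derive x 1 Q (r + d - 2 * x).
  by rewrite /Q; apply: is_derive_eq; rewrite /GRing.scale/= /m; field.
have cQ : continuous Q by rewrite /Q; continuity.
have Q0 x : d <= x <= r -> 0 < Q x.
  move=> /andP[dx xr]; rewrite /Q.
  have -> : r ^+ 2 - m ^+ 2 - (x - m) ^+ 2 =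
      (r - d) * (r + d) / 2 + (x - d) * (r - x) by rewrite /m; field.
  by rewrite ltr_wpDr ?divr_gt0 ?mulr_gt0 ?mulr_ge0//; lra.
have QE x : r ^+ 2 - x ^+ 2 = Q x + 2 * m * (m - x) by rewrite /Q; ring.
(* The affine factor is the derivative of [Q], so the antiderivative is a multiple of the power
   [3 / 2] of [Q], with equal end values as [Q d = Q r]. The witness is the midpoint of [d] and
   [m]. *)
apply: (@Rintegral_gt0_comparison _ _
  (fun x => (r + d - 2 * x) * (2 * Num.sqrt (Q x)))
  (fun x => 4 / 3 * (Q x * Num.sqrt (Q x))) _ _ ((3 * d + r) / 4)).
- by continuity.
- by continuity; exact: cQ.
- by continuity; exact: cQ.
- by apply/andP; split; lra.
- move=> x /andP[dx xr]; have Qx : 0 < Q x by apply: Q0; rewrite !ltW.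
  apply: (is_derive_eq (is_deriveZ (4 / 3) (is_derive_mul_sqrt Qx (dQ x)))).
  by rewrite /GRing.scale/=; field.
- by rewrite (_ : Q d = Q r)// /Q /m; field.
- move=> x /andP[dx xr].
  have -> : -2 * x + (r + d) = r + d - 2 * x by ring.
  have m0 : 0 < m by rewrite /m; lra.
  (* By [QE] and [0 < m], the radicand [r ^+ 2 - x ^+ 2] minus [Q x] has the sign of [m - x], as has
     the affine factor, so their product favours the true weight on both sides. *)
  have [xm|mx] := leP x m.
    rewrite ler_wpM2l ?ler_wpM2l ?ler_wsqrtr// ?QE; first by rewrite /m in xm; lra.
    by rewrite lerDl mulr_ge0; lra.
  rewrite ler_wnM2l ?ler_wpM2l ?ler_wsqrtr// ?QE; first by rewrite /m in mx; lra.
  by rewrite gerDl mulr_ge0_le0; lra.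
- set z := (3 * d + r) / 4.
  have -> : -2 * z + (r + d) = r + d - 2 * z by ring.
  have m0 : 0 < m by rewrite /m; lra.
  have zm : z < m by rewrite /m /z; lra.
  have Qz : 0 < Q z by apply: Q0; rewrite /z; apply/andP; split; lra.
  have Qz' : Q z < r ^+ 2 - z ^+ 2 by rewrite QE ltrDl mulr_gt0; lra.
  have fz : 0 < r + d - 2 * z by rewrite /z; lra.
  by rewrite ltr_pM2l// ltr_pM2l// ltr_sqrt// (lt_trans Qz).
Qed.

Lemma upright_segment_moment_gt r d : 0 < r -> - r < d -> d < r ->
  (2 * r + 3 * d) * fine (area R (upright_segment r d)) <
  5 * (\int[area R]_(P in upright_segment r d) P.1).
Proof.
move=> r0 rd dr.
rewrite -subr_gt0 -mulNr upright_segment_affine_moment//.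
pose x0 := (2 * r + 3 * d) / 5; pose K := 2 * Num.sqrt (r + x0).
have factor x : d <= x <= r ->
    Num.sqrt (r ^+ 2 - x ^+ 2) = Num.sqrt (r - x) * Num.sqrt (r + x).
  by move=> /andP[dx xr]; rewrite subr_sqr sqrtrM//; lra.
pose Q x := r - x.
have dQ (x : R) : is_derive x 1 Q (-1).
  by rewrite /Q; apply: is_derive_eq; lra.
(* The affine factor vanishes at [x0], where [r + x] is frozen in the weight. The antiderivative
   vanishes at both [d] and [r]; its product rule produces the coefficients 5, 2 and 3. The witness
   is the midpoint of [x0] and [r]. *)
apply: (@Rintegral_gt0_comparison _ _
  (fun x => (5 * x - 2 * r - 3 * d) * (K * Num.sqrt (r - x)))
  (fun x => - 2 * K * (x - d) * ((r - x) * Num.sqrt (r - x))) _ _ ((x0 + r) / 2)).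
- by continuity.
- by continuity.
- by continuity.
- by apply/andP; split; rewrite /x0; lra.
- move=> x /andP[dx xr].
  have dP : is_derive x 1 (fun x => - 2 * K * (x - d)) (- 2 * K).
    by apply: is_derive_eq; rewrite /GRing.scale/=; ring.
  have Qx : 0 < Q x by rewrite /Q; lra.
  apply: (is_derive_eq (is_deriveM dP (is_derive_mul_sqrt Qx (dQ x)))).
  by rewrite /GRing.scale/= /Q; field.
- by rewrite !subrr mulr0 mul0r mul0r mulr0.
- move=> x dxr; rewrite factor//; move: dxr => /andP[dx xr].
  have -> : 5 * x + - (2 * r + 3 * d) = 5 * x - 2 * r - 3 * d by ring.
  have -> : K * Num.sqrt (r - x) = 2 * (Num.sqrt (r - x) * Num.sqrt (r + x0)).
    by rewrite /K; ring.
  have s0 := sqrtr_ge0 (r - x).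
  (* The affine factor and [Num.sqrt (r + x) - Num.sqrt (r + x0)] never have opposite signs. *)
  have [xm|mx] := leP x0 x.
    by rewrite ler_wpM2l ?ler_wpM2l ?ler_wsqrtr//; rewrite /x0 in xm *; lra.
  by rewrite ler_wnM2l ?ler_wpM2l ?ler_wsqrtr//; rewrite /x0 in mx *; lra.
- set z := (x0 + r) / 2.
  have xz : x0 < z by rewrite /z /x0; lra.
  have zr : z < r by rewrite /z /x0; lra.
  have dz : d <= z by rewrite /z /x0; lra.
  rewrite factor; last by rewrite dz ltW.
  have -> : 5 * z + - (2 * r + 3 * d) = 5 * z - 2 * r - 3 * d by ring.
  have -> : K * Num.sqrt (r - z) = 2 * (Num.sqrt (r - z) * Num.sqrt (r + x0)).
    by rewrite /K; ring.
  have s0 : 0 < Num.sqrt (r - z) by rewrite sqrtr_gt0 subr_gt0.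
  have fz : 0 < 5 * z - 2 * r - 3 * d by rewrite /x0 in xz; lra.
  by rewrite !ltr_pM2l// ltr_sqrt; lra.
Qed.

(** Reflection in the axis preserves the segment and its area, so the integral equals its own
    opposite. *)
Lemma upright_segment_second_moment0 r d : 0 < r ->
  \int[area R]_(P in upright_segment r d) P.2 = 0.
Proof.
move=> r0; have mS := measurable_upright_segment r d.
have int2 : (area R).-integrable (upright_segment r d) (EFin \o snd).
  by apply: (@integrable_upright_segment _ _ _ _ r).
have SE : (fun P => (P.1, - P.2)) @^-1` upright_segment r d = upright_segment r d.
  by apply/seteqP; split => P; rewrite /upright_segment/= sqrrN.
have intN : (area R).-integrable (upright_segment r d) (EFin \o (fun P => - P.2)).
  apply: (@integrable_upright_segment _ _ _ _ r) => //.
    exact: measurableT_comp.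
  by move=> P _; rewrite normrN.
have := Rintegral_area_preserving area_preserving_reflection mS
  (measurable_snd : measurable_fun setT (snd : R * R -> R)).
rewrite SE => /(_ intN) E.
have : \int[area R]_(P in upright_segment r d) - P.2 =
    - \int[area R]_(P in upright_segment r d) P.2.
  under eq_Rintegral do rewrite -mulN1r.
  by rewrite RintegralZl// mulN1r.
lra.
Qed.

End centroid_of_upright_segment.

(** * Rigid motions carrying the upright segment into general position *)

Section placing_the_segment.
Context {R : realType}.
Notation line := (measurableTypeR R).
Notation plane := (line * line)%type.

(** With [p] and [q] the cosine and sine of an angle, this is a rotation followed by the translation
    by [O]. Keeping [p] and [q] instead of the angle leaves the identities polynomial. *)
Definition placement (O : plane) (p q : R) (P : plane) : plane :=
  (O.1 + (P.1 * p - P.2 * q), O.2 + (P.1 * q + P.2 * p)).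

Lemma area_preserving_placement (O : plane) (p q : R) : p ^+ 2 + q ^+ 2 = 1 ->
  area_preserving (placement O p q).
Proof.
move=> pq.
exact: (area_preserving_comp (area_preserving_translation O)
  (area_preserving_rotation pq)).
Qed.

Lemma measurable_placement_preimage (O : plane) (p q : R) (S : set plane) :
  p ^+ 2 + q ^+ 2 = 1 -> measurable (placement O p q @^-1` S) -> measurable S.
Proof.
move=> pq mS.
(* The inverse motion: [S] is the preimage under [U] of the preimage known to be measurable. *)
pose U (X : plane) : plane := ((X.1 - O.1) * p + (X.2 - O.2) * q,
  (X.2 - O.2) * p - (X.1 - O.1) * q).
have mU : measurable_fun setT U.
  apply: measurable_fun_pair.
    by apply: measurable_funD; apply: measurable_funM => //; apply: measurable_funB.
  by apply: measurable_funB; apply: measurable_funM => //; apply: measurable_funB.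
have UK X : placement O p q (U X) = X.
  have pqE u : u = u * (p ^+ 2 + q ^+ 2) by rewrite pq mulr1.
  rewrite /placement /U /= [RHS]surjective_pairing; congr pair.
    by rewrite -[RHS](subrKC O.1) [in RHS](pqE (X.1 - O.1)); ring.
  by rewrite -[RHS](subrKC O.2) [in RHS](pqE (X.2 - O.2)); ring.
rewrite (_ : S = U @^-1` (placement O p q @^-1` S)).
  by rewrite -[X in measurable X]setTI; exact: mU.
by apply/seteqP; split => X; rewrite /= UK.
Qed.

(** The coordinates of a placed point are affine in the original ones, so their integrals follow
    from the area and the moments [s * area] and 0. *)
Lemma barycenter_placement (O : plane) (p q r d : R) (S : set plane) :
  0 < r -> - r < d -> d < r -> p ^+ 2 + q ^+ 2 = 1 ->
  placement O p q @^-1` S = upright_segment r d ->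
  let s := (barycenter (upright_segment r d)).1 in
  barycenter S = placement O p q (s, 0).
Proof.
move=> r0 rd dr pq TS s.
have mS0 := measurable_upright_segment r d.
have [mT hT] := area_preserving_placement O pq.
have mS : measurable S.
  by apply: (measurable_placement_preimage (O := O) pq); rewrite TS.
have A0 := area_upright_segment_gt0 r0 rd dr.
have sE : \int[area R]_(P in upright_segment r d) P.1 =
    s * fine (area R (upright_segment r d)).
  by rewrite /s /barycenter /= divfK// gt_eqF.
have affine u v c : \int[area R]_(P in upright_segment r d)
    (u * P.1 + v * P.2 + c) = (u * s + c) * fine (area R (upright_segment r d)).
  have int u' v' c' := integrable_upright_segment_affine d u' v' c' r0.
  have int1 : (area R).-integrable (upright_segment r d) (EFin \o fst).
    by apply: (@integrable_upright_segment _ _ _ _ r).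
  have int2 : (area R).-integrable (upright_segment r d) (EFin \o snd).
    by apply: (@integrable_upright_segment _ _ _ _ r).
  have intc : (area R).-integrable (upright_segment r d) (EFin \o (fun=> c)).
    by apply: (@integrable_upright_segment _ _ _ _ `|c|).
  have int1u := integrableZl mS0 u int1.
  have int2v := integrableZl mS0 v int2.
  have intuv := integrableD mS0 int1u int2v.
  rewrite RintegralD// RintegralD// !RintegralZl// Rintegral_cst// sE.
  by rewrite upright_segment_second_moment0//; ring.
have AE : area R S = area R (upright_segment r d) by rewrite -TS hT.
have change (f : plane -> R) u v c : measurable_fun setT f ->
    (forall P, f (placement O p q P) = u * P.1 + v * P.2 + c) ->
    \int[area R]_(P in S) f P = (u * s + c) * fine (area R (upright_segment r d)).
  move=> mf fE; rewrite (Rintegral_area_preserving (conj mT hT))//.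
    by rewrite TS -(affine u v c); apply: eq_Rintegral => P _; exact: fE.
  rewrite TS; have := integrable_upright_segment_affine d u v c r0.
  by apply: eq_integrable => // P _ /=; rewrite fE.
rewrite [LHS]/barycenter AE (change fst p (- q) O.1)//; last first.
  by move=> P; rewrite /placement/=; ring.
rewrite (change snd q p O.2)//; last by move=> P; rewrite /placement/=; ring.
rewrite !mulfK ?gt_eqF// /placement /=; congr pair; ring.
Qed.

Lemma cos_le_of_norm_le (s t : R) : `|s| <= t -> t <= pi -> cos t <= cos s.
Proof.
move=> st tpi; have s0 := normr_ge0 s.
by rewrite -(cos_norm s) leNgt ltr_cos ?in_itv/= -?leNgt//; apply/andP; split; lra.
Qed.

Lemma circle_pointE (O : R * R) (r phi t : R) :
  circle_point O r t =
  placement O (cos phi) (sin phi) (r * cos (t - phi), r * sin (t - phi)).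
Proof.
rewrite -[in LHS](subrK phi t) /circle_point /placement /=.
rewrite (cosD _ phi) (sinD _ phi).
by congr pair; ring.
Qed.

(** Orientation is invariant under rigid motions, and for the upright chord at abscissa [x] it only
    compares [P.1] with [x]. *)
Lemma orient_placement (O P : R * R) (r p q x y : R) :
  p ^+ 2 + q ^+ 2 = 1 ->
  orient (placement O p q (x, - y)) (placement O p q (x, y))
    (placement O p q P) = 2 * y * (x - P.1).
Proof.
move=> pq; rewrite -[RHS]mulr1 -[X in _ = _ * X]pq /orient /placement /=; ring.
Qed.

Lemma eucl_dist_placement (O P Q : R * R) (p q : R) : p ^+ 2 + q ^+ 2 = 1 ->
  eucl_dist (placement O p q P) (placement O p q Q) = eucl_dist P Q.
Proof.
move=> pq; rewrite /eucl_dist /placement /=; congr Num.sqrt.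
by rewrite -[RHS]mulr1 -[X in _ = _ * X]pq; ring.
Qed.

End placing_the_segment.

(** * The segment in general position *)

Theorem theorem3p1 (R : realType) (O : R * R) (r a b : R)
    (r_gt0 : 0 < r) (lt_ab : a < b) (lt_b2pi : b < a + 2 * pi) :
  let B := segment_vertex O r a b in
  let D := segment_base_midpoint O r a b in
  let L := barycenter (circular_segment O r a b) in
  [/\ closed_segment B D L,
      eucl_dist L D < eucl_dist B L
    & eucl_dist B L < 3 / 2 * eucl_dist L D].
Proof.
move=> B D L.
(* [phi] is the direction of the vertex and [theta] half the angle of the arc; [d] is the signed
   distance from the centre to the chord, negative when the arc exceeds a semicircle. *)
pose phi := (a + b) / 2; pose theta := (b - a) / 2.
pose d := r * cos theta.
have [th0 thpi] : 0 < theta /\ theta < pi by rewrite /theta; split; lra.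
have sth : 0 < sin theta by apply: sin_gt0_pi; rewrite th0.
have cth : -1 < cos theta < 1.
  rewrite -ltr_norml -(@ltr_pXn2r _ 2) ?nnegrE// real_normK ?num_real//.
  by rewrite cos2sin2 expr1n ltrBlDr ltrDl exprn_gt0.
have /andP[cth1 cth2] := cth.
have rd : - r < d by rewrite -mulrN1 ltr_pM2l.
have dr : d < r by rewrite -[ltRHS]mulr1 ltr_pM2l.
pose T := placement O (cos phi) (sin phi).
have cs : cos phi ^+ 2 + sin phi ^+ 2 = 1 by exact: cos2Dsin2.
have aE : a = phi - theta by rewrite /phi /theta; field.
have bE : b = phi + theta by rewrite /phi /theta; field.
have AE : circle_point O r a = T (d, - (r * sin theta)).
  rewrite (circle_pointE O r phi) aE.
  rewrite (_ : phi - theta - phi = - theta); last by ring.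
  by rewrite cosN sinN mulrN.
have CE : circle_point O r b = T (d, r * sin theta).
  by rewrite (circle_pointE O r phi) bE (_ : phi + theta - phi = theta)//; ring.
have BE : B = T (r, 0).
  by rewrite /B /segment_vertex (circle_pointE O r phi) subrr cos0 sin0 mulr1 mulr0.
have DE : D = T (d, 0).
  rewrite /D /segment_base_midpoint AE CE /midpoint /T /placement /=.
  by congr pair; field.
have O0 : O = T (0, 0).
  by rewrite /T /placement /= !mul0r subrr !addr0 -surjective_pairing.
have TS : T @^-1` circular_segment O r a b = upright_segment r d.
  have orientE P : orient (circle_point O r a) (circle_point O r b) (T P) =
      2 * (r * sin theta) * (d - P.1) by rewrite AE CE orient_placement.
  have k0 : 0 < 2 * (r * sin theta) by rewrite !mulr_gt0.
  have discE P : (eucl_dist O (T P) <= r) = (P.1 ^+ 2 + P.2 ^+ 2 <= r ^+ 2).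
    rewrite [X in eucl_dist X _]O0 eucl_dist_placement// /eucl_dist /=.
    rewrite !sub0r !sqrrN.
    by rewrite -[in LHS](ger0_norm (ltW r_gt0)) -sqrtr_sqr ler_sqrt ?sqr_ge0.
  apply/seteqP; split => P; rewrite /circular_segment /upright_segment /= discE.
    move=> [Pr Pc]; split => //.
    (* The vertex alone decides the side: its orientation is strictly negative since [d < r], which
       forces [d <= P.1]. *)
    have := Pc (circle_point O r phi).
    rewrite (circle_pointE O r phi phi) subrr cos0 sin0 mulr1 mulr0 !orientE /=.
    have phi_arc : circle_arc O r a b (T (r, 0)).
      exists phi; last by rewrite (circle_pointE O r phi) subrr cos0 sin0 mulr1 mulr0.
      by rewrite /= in_itv/= aE bE; apply/andP; split; lra.
    move=> /(_ phi_arc).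
    by rewrite nmulr_rge0 ?pmulr_rle0 ?pmulr_rlt0 ?subr_le0 ?subr_lt0.
  move=> [Pr Pd]; split => // _ [t tab <-].
  (* Conversely every arc point lies beyond the chord, because its angle from [phi] is at most
     [theta] in absolute value. *)
  rewrite (circle_pointE O r phi t) !orientE /= mulr_le0// pmulr_rle0// subr_le0//.
  rewrite ler_pM2l//; apply: cos_le_of_norm_le; last exact: ltW.
  move: tab; rewrite /= in_itv/= aE bE ler_norml => /andP[at_ tb].
  by apply/andP; split; lra.
pose s := (barycenter (upright_segment r d)).1.
have LE : L = T (s, 0) by exact: barycenter_placement TS.
have A0 := area_upright_segment_gt0 r_gt0 rd dr.
have s_lt : 2 * s < r + d.
  rewrite /s /barycenter /= mulrA ltr_pdivrMr//.
  exact: upright_segment_moment_lt.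
have s_gt : 2 * r + 3 * d < 5 * s.
  rewrite /s /barycenter /= [ltRHS]mulrA ltr_pdivlMr//.
  exact: upright_segment_moment_gt.
have distE x y : eucl_dist (T (x, 0)) (T (y, 0)) = `|x - y|.
  by rewrite eucl_dist_placement// /eucl_dist /= subrr expr0n addr0 sqrtr_sqr.
(* The two bounds give [d < s < r], so the distances are [r - s] and [s - d], and the two claims are
   linear restatements of [s_lt] and [s_gt]. *)
rewrite LE BE DE !distE (@gtr0_norm _ (r - s)) ?(@gtr0_norm _ (s - d)); try lra.
split; try lra.
have rd0 : r - d != 0 by lra.
exists ((r - s) / (r - d)).
  by rewrite divr_ge0 ?ler_pdivrMr; lra.
by rewrite /T /placement /=; congr pair; field.
Qed.
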